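(* Let $(X,d)$ be a compact metric space, let $(x_i)_{i\ge1}$ and $(x'_i)_{i\ge1}$ be sequences in $X$, and let $(p_i)_{i\ge0}$ be a fast growing sequence. Let $z=z((p_i),(x_i))$ and $z'=z((p_i),(x'_i))$ be the associated Oxtoby sequences (with the same $(p_i)$). Suppose both $L((x_i))$ and $L((x'_i))$ have at least two points. Then for any isomorphism $f$ from $(\overline O(z),S)$ to $(\overline O(z'),S)$ we have $f(z)=S^m z'$ for some $m\in\mathbb Z$.
   Context: $S$ is the left shift on $X^{\mathbb Z}$, $S(x)(n)=x(n+1)$, and $\overline O(z)$ is the closure of $\{S^nz:n\in\mathbb Z\}$ in $X^{\mathbb Z}$. An isomorphism of systems $(A,S)\to(B,S)$ is a homeomorphism $h:A\to B$ with $h\circ S=S\circ h$. $L((x_i))$ denotes the $\omega$-limit set: the set of limits of convergent subsequences $(x_{n_k})$, $(n_k)$ strictly increasing. A sequence of natural numbers $(p_i)_{i\ge0}$ is fast growing if $p_0=1$, $p_i\mid p_{i+1}$ and $p_{i+1}/p_i\ge 3$ for all $i\ge0$. Given a fast growing sequence $(p_i)$ and a sequence $(x_i)_{i\ge1}$ in $X$, the Oxtoby sequence $z=z((p_i),(x_i))\in X^{\mathbb Z}$ is defined inductively: in step $1$ set $z(n)=x_1$ for all $n\equiv-1$ or $0\pmod{p_1}$. For $i\ge1$ and $k\in\mathbb Z$ let $J(i,k)$ be the set of $n\in[kp_i,(k+1)p_i)$ for which $z(n)$ is not yet defined at the end of step $i$; in step $i+1$ set $z(n)=x_{i+1}$ for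 all $n\in J(i,k)$ with $k\equiv-1$ or $0\pmod{p_{i+1}/p_i}$. This defines $z(n)$ for all $n\in\mathbb Z$. *)

(* Defs.v *)
From HB Require Import structures.
From mathcomp Require Import all_boot all_order all_algebra.
From mathcomp Require Import zify.
From mathcomp Require Import all_classical all_reals all_analysis.
Set Implicit Arguments.
Unset Strict Implicit.
Unset Printing Implicit Defensive.
Import Order.TTheory GRing.Theory Num.Theory.
Local Open Scope classical_set_scope.
Local Open Scope ring_scope.

Section Shift.
Variable X : Type.

Definition left_shift (y : {ptws int -> X}) : {ptws int -> X} :=
  fun n => y (n + 1).

(* [left_shiftz m] is S^m; the two lemmas below characterize it as the
   two-sided iterate of [left_shift]. *)
Definition left_shiftz (m : int) (y : {ptws int -> X}) : {ptws int -> X} :=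
  fun n => y (n + m).

Lemma left_shiftz0 y : left_shiftz 0 y = y.
Proof. by apply/funext => n; rewrite /left_shiftz addr0. Qed.

Lemma left_shiftzS m y : left_shiftz (m + 1) y = left_shift (left_shiftz m y).
Proof.
by apply/funext => n; rewrite /left_shiftz /left_shift -addrA (addrC 1 m).
Qed.

End Shift.

Section Systems.
Variable X : topologicalType.

Definition orbit_closure (z : {ptws int -> X}) : set {ptws int -> X} :=
  closure [set left_shiftz n z | n in [set: int]].

(* A map A -> B is represented by a total function whose values outside A are
   irrelevant. *)
Definition system_isomorphism (A B : set {ptws int -> X})
    (h : {ptws int -> X} -> {ptws int -> X}) : Prop :=
  [/\ set_bij A B h,
      {within A, continuous h},
      exists2 g : {ptws int -> X} -> {ptws int -> X},
        {within B, continuous g} & {in A, cancel h g} &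
      {in A, forall y, h (left_shift y) = left_shift (h y)}].

Definition omega_limit (x : nat -> X) : set X :=
  [set a | exists2 f : nat -> nat, increasing_seq f & x \o f @ \oo --> a].

End Systems.

Definition fast_growing (p : nat -> nat) : Prop :=
  p 0 = 1%N /\ forall i, (p i %| p i.+1)%N /\ (3 <= p i.+1 %/ p i)%N.

Section Oxtoby.
Variable X : choiceType.
Variables (p : nat -> nat) (x : nat -> X).

(* Sequences (x_i) with i >= 1 are indexed from 0: [x i] stands for x_(i+1).
   [oxtoby_stage i n] is [Some v] when z(n) = v is defined by the end of step i
   and [None] when z(n) is not yet defined.  The k with n in [k p_i, (k+1) p_i)
   is n %/ p_i; since p_0 = 1, step 1 is the general step applied at i = 0. *)
Fixpoint oxtoby_stage (i : nat) (n : int) : option X :=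
  if i is j.+1 then
    if oxtoby_stage j n is Some v then Some v
    else
      let k := (n %/ (p j)%:Z)%Z in
      let q := (p j.+1 %/ p j)%N%:Z in
      if (k == -1 %[mod q])%Z || (k == 0 %[mod q])%Z then Some (x j) else None
  else None.

(* The default [x 0] is never used when [p] is fast growing, see [oxtobyP]. *)
Definition oxtoby : {ptws int -> X} :=
  fun n => xget (x 0) [set v | exists i, oxtoby_stage i n = Some v].

Lemma oxtoby_stage_mono i j n v : (i <= j)%N ->
  oxtoby_stage i n = Some v -> oxtoby_stage j n = Some v.
Proof.
move=> /subnKC <-; elim: (j - i)%N => [|d IHd] h; first by rewrite addn0.
by rewrite addnS /= (IHd h).
Qed.

Lemma oxtoby_stageE i n v : oxtoby_stage i n = Some v -> oxtoby n = v.
Proof.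
move=> h; rewrite /oxtoby; case: xgetP => [w _ [j hj]|/(_ v)[]]; last by exists i.
have := oxtoby_stage_mono (leq_maxl i j) h.
by rewrite (oxtoby_stage_mono (leq_maxr i j) hj) => -[].
Qed.

Lemma oxtobyP n : fast_growing p ->
  exists i, oxtoby_stage i n = Some (oxtoby n).
Proof.
move=> [p0 hp].
have pgt i : (i < p i)%N.
  elim: i => [|i IHi]; first by rewrite p0.
  have [dv h3] := hp i.
  by rewrite -(divnK dv); nia.
suff [i [v hv]] : exists i v, oxtoby_stage i n = Some v.
  by exists i; rewrite (oxtoby_stageE hv).
exists (`|n|.+1)%N => /=.
case: (oxtoby_stage _ _) => [v|]; first by exists v.
set k := (n %/ _)%Z.
have hk : k = 0 \/ k = -1.
  rewrite {}/k; move: (p _) (pgt `|n|%N) => P hlt.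
  case: (ltP n 0) => hn; [right|left; by rewrite divz_small; lia].
  have -> : n = -1 * P%:Z + (n + P%:Z) by lia.
  by rewrite divzMDl ?divz_small ?addr0; lia.
by exists (x `|n|%N); case: hk => ->; rewrite eqxx ?orbT.
Qed.

End Oxtoby.

(* Main.v *)
Require Import Defs.
From HB Require Import structures.
From mathcomp Require Import all_boot all_order all_algebra.
From mathcomp Require Import zify ring.
From mathcomp Require Import all_classical all_reals all_analysis.
Set Implicit Arguments.
Unset Strict Implicit.
Unset Printing Implicit Defensive.
Import Order.TTheory GRing.Theory Num.Theory.
Local Open Scope classical_set_scope.
Local Open Scope ring_scope.

(* Every point y of the orbit closure of an Oxtoby sequence lies over a point g
   of the odometer lim Z/p_i, and y(n) is determined by g unless n + g is a
   hole, i.e. has no digit equal to 0 or q_i - 1, where q_i = p_(i+1)/p_i.  So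
   the fiber over g is a singleton when no translate n + g is a hole, while, if
   g itself is a hole, the fiber contains points with y(0) = a for every a in
   L((x_i)).  If f(z) lies over h, then f maps the fiber over g into the fiber
   over g + h, so by injectivity g + h has a hole whenever g does.  When h is
   not an integer, the digits of g can be chosen greedily so that g is a hole
   and infinitely many digits of g + h are 0 or q_i - 1, so that g + h has no
   hole.  Hence h is an integer m, and the fiber over m is {S^m z'}. *)

(** * Digits, holes and odometer arithmetic *)

Section Digits.
Variable p : nat -> nat.
Hypothesis hp : fast_growing p.

Lemma fast_growing_gt i : (i < p i)%N.
Proof.
case: hp => p0 hq; elim: i => [|i IHi]; first by rewrite p0.
have [dv h3] := hq i; rewrite -(divnK dv); nia.
Qed.

Lemma fast_growing_step i :
  exists2 q : nat, (3 <= q)%N & p i.+1 = (q * p i)%N.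
Proof.
case: hp => p0 hq; have [dv h3] := hq i.
by exists (p i.+1 %/ p i)%N; rewrite // divnK.
Qed.

Lemma fast_growing_dvd i j : (i <= j)%N -> (p i %| p j)%N.
Proof.
case: hp => p0 hq; move=> /subnKC <-; elim: (j - i)%N => [|d IHd].
  by rewrite addn0.
by rewrite addnS (dvdn_trans IHd) //; case: (hq (i + d)%N).
Qed.

Lemma fast_growing_dvdz i j (n : int) : (i <= j)%N ->
  ((p j)%:Z %| n)%Z -> ((p i)%:Z %| n)%Z.
Proof. by move=> /fast_growing_dvd ij; apply: dvdz_trans; rewrite /dvdz. Qed.

(** The test repeats the one in [oxtoby_stage], so that the two agree by conversion. *)
Definition end_digit (j : nat) (n : int) : bool :=
  let k := (n %/ (p j)%:Z)%Z in
  let q := (p j.+1 %/ p j)%N%:Z in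
  (k == -1 %[mod q])%Z || (k == 0 %[mod q])%Z.

(** The residue mod p_(j+1) is b p_j + r with b the j-th digit and 0 <= r < p_j, so 1 <= b <= q - 2
    becomes an interval condition on that residue. *)
Lemma end_digitE j n : end_digit j n =
  ~~ ((p j)%:Z <= (n %% (p j.+1)%:Z)%Z < (p j.+1)%:Z - (p j)%:Z).
Proof.
have [q q3 pE] := fast_growing_step j.
have p_gt0 : (0 < p j)%N by have := fast_growing_gt j; lia.
rewrite /end_digit pE mulnK //.
have := divz_eq n (p j)%:Z; set k := (n %/ _)%Z; set r := (n %% _)%Z => nE.
have r0 : 0 <= r by rewrite modz_ge0; lia.
have rp : r < (p j)%:Z by rewrite ltz_pmod; lia.
have := divz_eq k q%:Z; set a := (k %/ _)%Z; set b := (k %% _)%Z => kE.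
have b0 : 0 <= b by rewrite modz_ge0; lia.
have bq : b < q%:Z by rewrite ltz_pmod; lia.
have -> : (n %% (q * p j)%N)%Z = b * (p j)%:Z + r.
  rewrite nE kE.
  have -> : (a * q%:Z + b) * (p j)%:Z + r =
    a * (q * p j)%N%:Z + (b * (p j)%:Z + r) by rewrite PoszM; ring.
  rewrite modzMDl modz_small //; nia.
have -> : (-1 %% q)%Z = q%:Z - 1.
  have -> : -1 = -1 * q%:Z + (q%:Z - 1) by ring.
  by rewrite modzMDl modz_small //; lia.
rewrite mod0z -/b.
apply/idP/idP; last first.
  apply: contraR; rewrite negb_or => /andP[/eqP b1 /eqP b2].
  apply/andP; split; nia.
move=> /orP[|] /eqP ->; rewrite negb_and -!ltNge -?leNgt; apply/orP;
  [right|left]; nia.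
Qed.

Lemma end_digit_congr i j m n : (j < i)%N -> ((p i)%:Z %| m - n)%Z ->
  end_digit j m = end_digit j n.
Proof.
move=> ji /(fast_growing_dvdz ji); rewrite -eqz_mod_dvd => /eqP mn.
by rewrite !end_digitE mn.
Qed.

(** These are the positions left undefined after step i, see [oxtoby_stageN]. *)
Definition hole i n := forall j, (j < i)%N -> ~~ end_digit j n.

Lemma hole_congr i m n : ((p i)%:Z %| m - n)%Z -> hole i m -> hole i n.
Proof. by move=> mn hm j ji; rewrite -(end_digit_congr ji mn) hm. Qed.

Lemma holeS i n : hole i.+1 n <-> hole i n /\ ~~ end_digit i n.
Proof.
split=> [h|[h e] j]; first by split=> [j ji|]; apply: h => //; exact: ltnW.
by rewrite ltnS leq_eqVlt => /predU1P[->//|]; apply: h.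
Qed.

(* Coherent sequences of residues are the elements of the odometer
   lim Z/p_i. *)
Definition coherent (g : nat -> int) :=
  forall i, ((p i)%:Z %| g i.+1 - g i)%Z.

Lemma coherent_leq g i j : coherent g -> (i <= j)%N ->
  ((p i)%:Z %| g j - g i)%Z.
Proof.
move=> cg /subnKC <-; elim: (j - i)%N => [|d IHd].
  by rewrite addn0 subrr dvdz0.
have -> : g (i + d.+1)%N - g i =
    (g (i + d).+1 - g (i + d)%N) + (g (i + d)%N - g i).
  by rewrite addnS; ring.
by rewrite rpredD ?IHd //; apply: fast_growing_dvdz (cg _); exact: leq_addr.
Qed.

(** Since digit j is interior, the residue of n mod p_(j+1) is at least p_j away from both multiples
    of p_(j+1) around n, so subtracting m does not carry into digit j + 1. *)
Lemma end_digit_shift j (m n : int) : (absz m < p j)%N ->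
  ~~ end_digit j n -> end_digit j.+1 (n - m) = end_digit j.+1 n.
Proof.
move=> mp; rewrite !end_digitE negbK.
have [q q3 pE] := fast_growing_step j.+1; rewrite pE.
have := fast_growing_gt j.+1; move: (p j.+1) (p j) mp => Q P mP Q_gt.
have := divz_eq n Q%:Z; set k := (n %/ _)%Z; set r := (n %% _)%Z.
move=> nE /andP[r1 r2].
have := divz_eq k q%:Z; set a := (k %/ _)%Z; set b := (k %% _)%Z => kE.
have b0 : 0 <= b by rewrite modz_ge0; lia.
have bq : b < q%:Z by rewrite ltz_pmod; lia.
have -> : n - m = a * (q * Q)%N%:Z + (b * Q%:Z + (r - m)).
  by rewrite nE kE PoszM; ring.
have -> : n = a * (q * Q)%N%:Z + (b * Q%:Z + r).
  by rewrite nE kE PoszM; ring.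
have bQ0 : 0 <= b * Q%:Z by nia.
have bQ1 : b * Q%:Z <= (q * Q)%N%:Z - Q%:Z by nia.
rewrite !modzMDl.
rewrite (@modz_small (b * Q%:Z + r)) ?(@modz_small (b * Q%:Z + (r - m))); try lia.
have [b1|b1] := leP b 0; first by have b00 : b = 0; lia.
have [b2|b2] := leP (q%:Z - 1) b; first by have bq1 : b = q%:Z - 1; nia.
have : Q%:Z <= b * Q%:Z by nia.
have : b * Q%:Z <= (q * Q)%N%:Z - 2 * Q%:Z by nia.
by lia.
Qed.

(* Carries stop at a digit which is neither 0 nor q_j - 1, so translating a hole
   by the integer n only changes finitely many digits. *)
Lemma hole_end_digitN g n : coherent g -> (forall i, hole i (n + g i)) ->
  exists N, forall j, (N <= j)%N -> ~~ end_digit j (g j.+1).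
Proof.
move=> cg hg; exists `|n|%N.+1 => -[//|j] nj.
have /holeS[/holeS[_ ej] ejS] := hg j.+2.
have {}nj : (`|n| < p j)%N by apply: leq_trans (fast_growing_gt j); lia.
by rewrite -(end_digit_shift nj ej) addrC addKr in ejS.
Qed.

(** Let k be the leading digit of t. If k = q - 1, adding d = 1 wraps it to 0; if 1 <= k <= q - 2,
    adding d = q - 1 - k turns it into q - 1. Only k = 0 leaves no such choice. *)
Lemma escape_digit (P q : nat) (t : int) : (0 < P)%N -> (3 <= q)%N ->
    0 <= t < (q * P)%N%:Z ->
  exists2 d : int, 1 <= d <= q%:Z - 2 & P%:Z <= t ->
    ~~ (P%:Z <= ((t + d * P%:Z) %% (q * P)%N)%Z < (q * P)%N%:Z - P%:Z).
Proof.
move=> P0 q3 /andP[t0 tqP].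
have [tP|tP] := ltP t P%:Z; first by exists 1; lia.
have [tQ|tQ] := ltP t ((q * P)%N%:Z - P%:Z); last first.
  exists 1; first lia.
  move=> _; have -> : t + 1 * P%:Z = 1 * (q * P)%N%:Z + (t + P%:Z - (q * P)%N%:Z).
    by ring.
  by rewrite modzMDl modz_small; lia.
have := divz_eq t P%:Z; set k := (t %/ _)%Z; set r := (t %% _)%Z => tE.
have r0 : 0 <= r by rewrite modz_ge0; lia.
have rp : r < P%:Z by rewrite ltz_pmod; lia.
have k1 : 1 <= k by nia.
have k2 : k <= q%:Z - 2 by nia.
exists (q%:Z - 1 - k); first lia.
move=> _; rewrite tE.
have -> : k * P%:Z + r + (q%:Z - 1 - k) * P%:Z = (q * P)%N%:Z - P%:Z + r.
  by rewrite PoszM; ring.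
by rewrite modz_small; lia.
Qed.

(* Greedy choice of the digits of [g]: as soon as the digit of [h], together
   with the carry, acts nontrivially, it can be completed to 0 or q_i - 1. *)
Lemma escape_odometer h : coherent h ->
  (exists m, forall i, ((p i)%:Z %| h i - m)%Z) \/
  exists g, [/\ coherent g, forall i, hole i (g i) &
    forall n, ~ forall i, hole i (n + (g i + h i))].
Proof.
move=> ch.
have p0 i : (0 < p i)%N by have := fast_growing_gt i; lia.
(* Here [a] is the part of g already built and [d] its next digit, kept between 1 and q_i - 2 so
   that g stays a hole. *)
pose good i (a d : int) := [/\ 1 <= d,
  d * (p i)%:Z <= (p i.+1)%:Z - 2 * (p i)%:Z &
  let t := ((h i.+1 + a) %% (p i.+1)%:Z)%Z in
  (p i)%:Z <= t -> end_digit i (t + d * (p i)%:Z)].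
have /choice[D hD] : forall ia : nat * int, exists d, good ia.1 ia.2 d.
  move=> [i a] /=; have [q q3 pE] := fast_growing_step i.
  have [|d /andP[d1 d2] hd] :=
      @escape_digit (p i) q ((h i.+1 + a) %% (p i.+1)%:Z)%Z (p0 i) q3.
    by rewrite modz_ge0 -?pE ?ltz_pmod; have := p0 i.+1; lia.
  exists d; split=> //; first by rewrite pE PoszM; nia.
  by move=> t ht; rewrite end_digitE pE hd.
have [g g0 gS] : exists2 g : nat -> int, g 0%N = 0 &
    forall i, g i.+1 = g i + D (i, g i) * (p i)%:Z.
  by exists (nat_rect (fun=> int) 0 (fun i a => a + D (i, a) * (p i)%:Z)).
have cg : coherent g by move=> i; rewrite gS addrC addKr dvdz_mull.
have g_bnd i : 0 <= g i < (p i)%:Z.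
  elim: i => [|i IHi]; first by rewrite g0; have := p0 0%N; lia.
  by have [/= d1 d2 _] := hD (i, g i); rewrite gS; nia.
have g_hole i : hole i (g i).
  elim: i => [//|i IHi]; apply/holeS; split.
    by apply: hole_congr IHi; rewrite -rpredN opprB.
  have [/= d1 d2 _] := hD (i, g i).
  rewrite end_digitE negbK modz_small ?g_bnd // gS.
  by have := g_bnd i; nia.
pose t i := ((h i.+1 + g i) %% (p i.+1)%:Z)%Z.
(* If t_i >= p_i infinitely often, then g + h has infinitely many end digits, which
   [hole_end_digitN] excludes for a hole. *)
have [t_small|t_large] :=
    pselect (exists N, forall i, (N <= i)%N -> t i < (p i)%:Z); last first.
  right; exists g; split=> // n hn.
  have cgh : coherent (fun i => g i + h i).
    by move=> i; rewrite opprD addrACA rpredD.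
  have [N hN] := hole_end_digitN cgh hn; apply: t_large; exists N => i Ni.
  rewrite ltNge; apply: contra (hN i Ni) => ti.
  have [/= _ _ /(_ ti)] := hD (i, g i).
  rewrite (@end_digit_congr i.+1 i _ (g i.+1 + h i.+1)) //.
  rewrite gS -eqz_mod_dvd; apply/eqP; rewrite modzDml; congr (_ %% _)%Z; ring.
(* From N on, t_i < p_i forces t_i = r_i, and adding the next digit of g stays below p_(i+1). So r_i
   - g_i is constant from N on, and it is congruent to h_i mod p_i. *)
left; case: t_small => N t_small.
pose r i := ((h i + g i) %% (p i)%:Z)%Z.
have rS i : (N <= i)%N -> r i.+1 = r i + D (i, g i) * (p i)%:Z.
  move=> Ni; have ti := t_small i Ni.
  have t0 : 0 <= t i by rewrite modz_ge0; have := p0 i.+1; lia.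
  have <- : t i = r i.
    have /eqP : (h i.+1 + g i == h i + g i %[mod (p i)%:Z])%Z.
      by rewrite eqz_mod_dvd opprD addrACA subrr addr0.
    rewrite -/(r i) => <-.
    rewrite -[LHS](@modz_small _ (p i)%:Z); last lia.
    apply/eqP; rewrite eqz_mod_dvd.
    apply: (@fast_growing_dvdz i i.+1) => //.
    by rewrite -eqz_mod_dvd /t modz_mod.
  have [/= d1 d2 _] := hD (i, g i).
  rewrite -[RHS](@modz_small _ (p i.+1)%:Z); last nia.
  by rewrite /r /t modzDml gS addrA.
exists (r N - g N).
have main i : (N <= i)%N -> ((p i)%:Z %| h i - (r N - g N))%Z.
  move=> Ni; have -> : r N - g N = r i - g i.
    rewrite -(subnKC Ni); elim: (i - N)%N => [|e IHe]; first by rewrite addn0.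
    by rewrite addnS rS ?leq_addr // gS IHe; ring.
  have -> : h i - (r i - g i) = (h i + g i) - r i by ring.
  by rewrite -eqz_mod_dvd /r modz_mod.
(* Levels below N follow from level N by coherence. *)
move=> i; have [/main//|/ltnW iN] := leqP N i.
have -> : h i - (r N - g N) = (h N - (r N - g N)) - (h N - h i) by ring.
by rewrite rpredB ?coherent_leq //; apply: fast_growing_dvdz iN (main N _).
Qed.

End Digits.

(** * Stages of the Oxtoby construction in terms of holes *)

Section Stages.
Variables (X : choiceType) (p : nat -> nat) (x : nat -> X).

Lemma oxtoby_stageN i n : oxtoby_stage p x i n = None <-> hole p i n.
Proof.
elim: i => [//|i IHi].
have -> : oxtoby_stage p x i.+1 n = if oxtoby_stage p x i n is Some v then Some v
  else if end_digit p i n then Some (x i) else None by [].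
rewrite holeS; case E : (oxtoby_stage p x i n) => [v|].
  by split=> // -[/IHi]; rewrite E.
by case: ifP => e; split=> [|[]] // _; split=> //; apply/IHi.
Qed.

Lemma oxtoby_stage_hole i n : hole p i n -> end_digit p i n ->
  oxtoby_stage p x i.+1 n = Some (x i).
Proof. by move=> /oxtoby_stageN hi; rewrite /end_digit /= hi => ->. Qed.

Lemma oxtoby_stage_congr i m n : fast_growing p -> ((p i)%:Z %| m - n)%Z ->
  oxtoby_stage p x i m = oxtoby_stage p x i n.
Proof.
move=> hp; elim: i => [//|i IHi] mn /=.
rewrite IHi; last exact: fast_growing_dvdz mn.
case: (oxtoby_stage p x i n) => //.
by have := end_digit_congr hp (ltnSn i) mn; rewrite /end_digit => ->.
Qed.

End Stages.

(** * Closures of images and of finite unions *)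

Lemma closure_within_image (S T : topologicalType) (A B : set S) (f : S -> T) y :
  {within A, continuous f} -> B `<=` A -> A y ->
  closure B y -> closure (f @` B) (f y).
Proof.
move=> /subspace_continuousP cf BA Ay By N /(cf _ Ay) /By[b [Bb Nb]].
by exists (f b); split; [exists b | apply: Nb; exact: BA].
Qed.

Lemma closure_bigcup_lt (T : topologicalType) (A : nat -> set T) n y :
  closure (\bigcup_(s in `I_n) A s) y -> exists2 s, (s < n)%N & closure (A s) y.
Proof.
rewrite bigcup_mkord; elim: n => [|n IHn].
  by rewrite big_ord0 closure0.
rewrite big_ord_recr closureU => -[/IHn[s sn]|]; last by exists n.
by exists s => //; exact: ltnW.
Qed.

(** * Orbit closures over the odometer *)

Section Odometer.
Variables (X : topologicalType) (p : nat -> nat).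
Implicit Types (y z : {ptws int -> X}) (g h : nat -> int).

Lemma left_shiftzD m n z :
  left_shiftz m (left_shiftz n z) = left_shiftz (m + n) z.
Proof. by apply/funext => k; rewrite /left_shiftz addrA. Qed.

Lemma left_shift_inj : injective (@left_shift X).
Proof.
move=> y z e; apply/funext => n.
by have := congr1 (fun u => u (n - 1)) e; rewrite /left_shift subrK.
Qed.

Lemma left_shiftz_continuous m :
  continuous (left_shiftz m : {ptws int -> X} -> {ptws int -> X}).
Proof.
suff H y : left_shiftz m u @[u --> y] --> left_shiftz m y by move=> y; exact: H.
have Fy : Filter (nbhs y) := nbhs_filter y.
have FF := fmap_filter (left_shiftz m) Fy.
(* The pointwise topology is the supremum of those induced by the coordinates, and coordinate n of
   the shift is coordinate n + m. *)
apply/(cvg_sup _ _ FF) => n A [B [[C oC <-] Cy] BA].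
have : nbhs y (proj (n + m) @^-1` C).
  by apply: proj_continuous; apply: open_nbhs_nbhs; split.
by apply: filterS => u Cu; apply: BA.
Qed.

Definition orbit_class z (P : nat) (r : int) : set {ptws int -> X} :=
  [set left_shiftz m z | m in [set m | (P%:Z %| m - r)%Z]].

(** Lying over [g] is a relation rather than the value of a factor map, so it makes sense for
    arbitrary [z]. *)
Definition fiber z g : set {ptws int -> X} :=
  [set y | forall i, closure (orbit_class z (p i) (g i)) y].

Lemma orbit_class_sub z P r : orbit_class z P r `<=` orbit_closure z.
Proof. by move=> _ [m _ <-]; apply: subset_closure; exists m. Qed.

Lemma fiber_orbit_closure z g y : fiber z g y -> orbit_closure z y.
Proof.
by move=> /(_ 0%N); apply: closureS => _ [m _ <-]; exists m.
Qed.

Lemma fiber_shift z m : fiber z (fun=> m) (left_shiftz m z).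
Proof. by move=> i; apply: subset_closure; exists m; rewrite //= subrr dvdz0. Qed.

(** A class mod p_i splits into q_i classes mod p_(i+1), and closure commutes with finite unions, so
    a class whose closure contains y can be refined step by step. *)
Lemma orbit_closure_fiber z y : fast_growing p -> orbit_closure z y ->
  exists2 g, coherent p g & fiber z g y.
Proof.
move=> hp zy.
have /choice[D hD] : forall ir : nat * int, exists r',
    closure (orbit_class z (p ir.1) ir.2) y ->
    ((p ir.1)%:Z %| r' - ir.2)%Z /\ closure (orbit_class z (p ir.1.+1) r') y.
  move=> [i r] /=; have [yr|nyr] := pselect (closure (orbit_class z (p i) r) y);
    last by exists 0.
  have [q q3 pE] := fast_growing_step hp i.
  have [|s _ ys] := @closure_bigcup_lt _
      (fun s : nat => orbit_class z (p i.+1) (r + s%:Z * (p i)%:Z)) q y.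
    apply: closureS yr => _ [m /dvdzP[k mr] <-].
    (* As m = r + k p_i, the subclass containing m is given by k mod q. *)
    exists `|(k %% q)%Z|%N; first by rewrite /=; lia.
    exists m => //=; apply/dvdzP; exists (k %/ q)%Z.
    have := divz_eq k q; rewrite pE PoszM => kE.
    have -> : (`|(k %% q)%Z|%N : int) = (k %% q)%Z by lia.
    by rewrite opprD addrA mr {1}kE; ring.
  by exists (r + s%:Z * (p i)%:Z); rewrite addrC addKr dvdz_mull.
have [g g0 gS] : exists2 g : nat -> int, g 0%N = 0 &
    forall i, g i.+1 = D (i, g i).
  by exists (nat_rect (fun=> int) 0 (fun i a => D (i, a))).
have yg : fiber z g y.
  elim=> [|i /(hD (i, g i))[_]]; last by rewrite gS.
  apply: closureS zy => _ [m _ <-]; exists m => //=.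
  by case: hp => -> _; rewrite dvd1z.
by exists g => // i; rewrite gS; have [] := hD (i, g i) (yg i).
Qed.

(** If m = g_i and n = h_i mod p_i, then S^m z is sent to S^m f(z), a limit of points S^(m+n) w;
    continuity of f passes this to y. *)
Lemma fiber_image z w (f : {ptws int -> X} -> {ptws int -> X}) g h y :
  {within orbit_closure z, continuous f} ->
  (forall m, f (left_shiftz m z) = left_shiftz m (f z)) ->
  fiber w h (f z) -> fiber z g y -> fiber w (fun i => g i + h i) (f y).
Proof.
move=> cf fS wh yg i.
have := closure_within_image cf (@orbit_class_sub z (p i) (g i))
  (fiber_orbit_closure yg) (yg i).
have /closure_id -> := @closed_closure _ (orbit_class w (p i) (g i + h i)).
apply: closureS => _ [_ [m mg <-] <-]; rewrite fS.
have /continuous_subspaceT cS := @left_shiftz_continuous m.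
have := closure_within_image (cS setT) (@subsetT _ _) I (wh i).
apply: closureS => _ [_ [n nh <-] <-]; exists (m + n); last by rewrite left_shiftzD.
by rewrite /= opprD addrACA rpredD.
Qed.

End Odometer.

(** * Fibers of an Oxtoby sequence *)

Section OxtobyFibers.
Variables (X : topologicalType) (p : nat -> nat) (x : nat -> X).
Hypotheses (hp : fast_growing p) (hX : hausdorff_space X).
Let z := oxtoby p x.

(** What is filled by step i is p_i-periodic, so all S^m z with m = g_i mod p_i share their value at
    n, and singletons are closed. *)
Lemma fiber_value g y i n : fiber p z g y -> ~ hole p i (n + g i) ->
  y n = z (n + g i).
Proof.
move=> /(_ i) yg nh.
case E : (oxtoby_stage p x i (n + g i)) => [v|]; last first.
  by case: nh; apply/oxtoby_stageN; exact: E.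
rewrite /z (oxtoby_stageE E).
have cn : {within [set: {ptws int -> X}], continuous (proj n : _ -> X)}.
  by apply: continuous_subspaceT; exact: (@proj_continuous int (fun=> X) n).
have := closure_within_image cn (@subsetT _ _) I yg.
have /closureS : proj n @` orbit_class z (p i) (g i) `<=` [set v].
  move=> _ [_ [m mg <-] <-] /=; rewrite /proj /left_shiftz /z.
  apply: (@oxtoby_stageE _ p x i).
  by rewrite (oxtoby_stage_congr _ hp (n := n + g i)) // opprD addrACA subrr add0r.
move=> /[apply]; rewrite -(closure_id _).1 //.
by apply: accessible_closed_set1; exact: hausdorff_accessible.
Qed.

Lemma fiber_no_hole g y y' :
  (forall n, ~ forall i, hole p i (n + g i)) ->
  fiber p z g y -> fiber p z g y' -> y = y'.
Proof.
move=> nh yg y'g; apply/funext => n.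
have /existsNP[i nhi] := nh n.
by rewrite (fiber_value yg nhi) (fiber_value y'g nhi).
Qed.

Lemma integer_no_hole m n : ~ forall i, hole p i (n + m).
Proof.
have [i hi] := oxtobyP x (n + m) hp.
by move=> /(_ i)/(oxtoby_stageN _ x); rewrite hi.
Qed.

(** The point y is a cluster point of shifts S^(m_i) z with m_i = g_i mod p_i and z(m_i) = x(s_i),
    which tends to a. *)
Lemma fiber_hole g a : compact [set: X] -> coherent p g ->
  (forall i, hole p i (g i)) -> omega_limit x a ->
  exists2 y, fiber p z g y & y 0 = a.
Proof.
move=> cX cg hg [s /increasing_seqP s_incr xs].
have s_ge i : (i <= s i)%N.
  by elim: i => [//|i IHi]; apply: leq_ltn_trans IHi (s_incr i).
(* The representative in [0, p_(s i)) has digit 0 at place s i, so it is filled exactly at step s i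
   + 1, with value [x (s i)]. *)
pose m i := (g (s i) %% (p (s i))%:Z)%Z.
have mg i : ((p i)%:Z %| m i - g i)%Z.
  have -> : m i - g i = (m i - g (s i)) + (g (s i) - g i) by ring.
  rewrite rpredD ?coherent_leq //.
  by apply: (fast_growing_dvdz hp (s_ge i)); rewrite -eqz_mod_dvd modz_mod.
have zm i : z (m i) = x (s i).
  apply: (@oxtoby_stageE _ p x (s i).+1); apply: oxtoby_stage_hole.
    by apply: hole_congr (hg (s i)) => //; rewrite -eqz_mod_dvd modz_mod.
  have p_gt0 : (0 < p (s i))%N by apply: leq_ltn_trans (fast_growing_gt hp _).
  have -> // : end_digit p (s i) (m i).
  rewrite /end_digit divz_small ?eqxx ?orbT // modz_ge0 ?ltz_pmod; lia.
pose u i : {ptws int -> X} := left_shiftz (m i) z.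
have cXZ : compact [set: {ptws int -> X}].
  have := @tychonoff int (fun=> X) (fun=> setT) (fun=> cX).
  by congr compact; apply/seteqP; split.
have [y [_ yu]] := cXZ (u @ \oo) _ filterT.
exists y.
  move=> i; move: yu; rewrite clusterE; apply.
  exists i => // j /= ij; exists (m j) => //=.
  have -> : m j - g i = (m j - g j) + (g j - g i) by ring.
  by rewrite rpredD ?coherent_leq //; exact: (fast_growing_dvdz hp ij (mg j)).
(* Neighborhoods of a and y(0) always meet, as y is a cluster point. *)
apply/esym/hX => A B nA nB.
have /yu H : (u @ \oo) (proj 0 @^-1` A).
  have [N _ hN] := xs _ nA; exists N => // i /hN.
  by rewrite /= /u /proj /left_shiftz add0r zm.
by have [v [Av Bv]] := H _ (@proj_continuous _ _ 0 y _ nB); exists (v 0).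
Qed.

End OxtobyFibers.

(** * Isomorphisms and the conclusion *)

Lemma isomorphism_shiftz (X : topologicalType) (z : {ptws int -> X}) B f m :
  system_isomorphism (orbit_closure z) B f ->
  f (left_shiftz m z) = left_shiftz m (f z).
Proof.
case=> _ _ _ fS.
have orb n : left_shiftz n z \in orbit_closure z.
  by rewrite inE; apply: subset_closure; exists n.
elim: m => [|n IHn|n IHn]; first by rewrite !left_shiftz0.
  by rewrite -addn1 PoszD !left_shiftzS fS // IHn.
apply: left_shift_inj; rewrite -fS // -!left_shiftzS.
by have -> : - n.+1%:Z + 1 = - n%:Z by rewrite -addn1 PoszD; ring.
Qed.

Theorem theorem5p1 (R : realType) (X : metricType R)
  (cX : compact [set: X])
  (x x' : nat -> X) (p : nat -> nat)
  (hp : fast_growing p)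
  (hx : exists a b, [/\ omega_limit x a, omega_limit x b & a <> b])
  (hx' : exists a b, [/\ omega_limit x' a, omega_limit x' b & a <> b])
  (f : {ptws int -> X} -> {ptws int -> X})
  (hf : system_isomorphism (orbit_closure (oxtoby p x))
                           (orbit_closure (oxtoby p x')) f) :
  exists m : int, f (oxtoby p x) = left_shiftz m (oxtoby p x').
Proof.
have hX : hausdorff_space X := @metric_hausdorff R X.
have fS m := isomorphism_shiftz m hf.
have [[f_fun f_inj _] cf _ _] := hf.
have zz : orbit_closure (oxtoby p x) (oxtoby p x).
  by apply: subset_closure; exists 0 => //; rewrite left_shiftz0.
have [h ch fzh] := orbit_closure_fiber hp (f_fun _ zz).
have [[m hm]|[g [cg hg nh]]] := escape_odometer hp ch.
  (* Integers are never holes at all levels, so the fiber over m is a single point, and h and m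
     define the same fiber. *)
  exists m; apply: (fiber_no_hole hp hX (@integer_no_hole _ _ x' hp m)).
    move=> i; apply: closureS (fzh i) => _ [n nh <-]; exists n => //=.
    by rewrite -(subrK (h i) n) -addrA rpredD.
  exact: fiber_shift.
(* Otherwise two points over g, with values a and b at 0, both land in the one-point fiber over g +
   h. *)
have [a [b [La Lb ab]]] := hx.
have [y yg y0] := fiber_hole hp hX cX cg hg La.
have [y' y'g y'0] := fiber_hole hp hX cX cg hg Lb.
case: ab; rewrite -y0 -y'0; congr (_ 0).
apply: f_inj; [by rewrite inE; exact: fiber_orbit_closure yg
              |by rewrite inE; exact: fiber_orbit_closure y'g|].
by apply: (fiber_no_hole hp hX nh); apply: fiber_image.
Qed.
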